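(* Let $\mathscr{H}$ be any Hilbert $C^*$-module and let $P,Q\in\mathcal{L}(\mathscr{H})$ be two projections. Then for any $\varepsilon\in(0,1)$, there exists a projection $Q'\in\mathcal{L}(\mathscr{H})$ such that $\|Q-Q'\|<\varepsilon$ and the equation $$(P+Q')^{1/2}X=P,\quad X\in\mathcal{L}(\mathscr{H})$$ has a solution.
   Context: $\mathcal{L}(\mathscr{H})$ denotes the $C^*$-algebra of adjointable operators on the Hilbert $C^*$-module $\mathscr{H}$ (over an arbitrary $C^*$-algebra); a projection is a self-adjoint idempotent in $\mathcal{L}(\mathscr{H})$. *)

(* Defs.v *)
From HB Require Import structures.
From mathcomp Require Import all_boot all_order all_algebra.
From mathcomp Require Import complex.
From mathcomp Require Import boolp classical_sets reals constructive_ereal ereal.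
From mathcomp Require Import topology normedtype.

Set Implicit Arguments.
Unset Strict Implicit.
Unset Printing Implicit Defensive.

Import Order.TTheory GRing.Theory Num.Theory.
Import numFieldNormedType.Exports.

Local Open Scope classical_set_scope.
Local Open Scope ring_scope.
Local Open Scope complex_scope.

(* C*-algebras are not assumed to be unital, so that the product is a bare
   operation instead of the multiplication of a (unital) MathComp ring. *)
HB.mixin Record isCStarAlgebra (R : realType) A
    of CompleteNormedModule R[i] A := {
  cmul : A -> A -> A;
  cstar : A -> A;
  cmulA : associative cmul;
  cmulDl : left_distributive cmul +%R;
  cmulDr : right_distributive cmul +%R;
  cmulZl : forall (k : R[i]) (a b : A), cmul (k *: a) b = k *: cmul a b;
  cmulZr : forall (k : R[i]) (a b : A), cmul a (k *: b) = k *: cmul a b;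
  cstarK : involutive cstar;
  cstarD : {morph cstar : a b / a + b};
  cstarZ : forall (k : R[i]) (a : A), cstar (k *: a) = k^* *: cstar a;
  cstarM : forall a b : A, cstar (cmul a b) = cmul (cstar b) (cstar a);
  norm_cmul : forall a b : A, `|cmul a b| <= `|a| * `|b|;
  norm_cstar_cmul : forall a : A, `|cmul (cstar a) a| = `|a| ^+ 2
}.

#[short(type="cstarAlgType")]
HB.structure Definition CStarAlgebra (R : realType) :=
  {A of isCStarAlgebra R A & CompleteNormedModule R[i] A}.

Definition cpositive (R : realType) (A : cstarAlgType R) (a : A) : Prop :=
  exists b : A, a = cmul (cstar b) b.

(* Right Hilbert A-modules, with an inner product that is linear in its second
   variable. The last axiom says that the Banach space norm of H is
   x |-> `|<x, x>| ^ (1/2), so that H is complete for that norm. *)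
HB.mixin Record isHilbertModule (R : realType) (A : cstarAlgType R) H
    of CompleteNormedModule R[i] H := {
  hact : H -> A -> H;
  hinner : H -> H -> A;
  hactDl : forall (x y : H) (a : A), hact (x + y) a = hact x a + hact y a;
  hactDr : forall (x : H) (a b : A), hact x (a + b) = hact x a + hact x b;
  hactA : forall (x : H) (a b : A), hact x (cmul a b) = hact (hact x a) b;
  hactZl : forall (k : R[i]) (x : H) (a : A),
    hact (k *: x) a = k *: hact x a;
  hactZr : forall (k : R[i]) (x : H) (a : A),
    hact x (k *: a) = k *: hact x a;
  hinnerDr : forall x y z : H, hinner x (y + z) = hinner x y + hinner x z;
  hinnerZr : forall (k : R[i]) (x y : H), hinner x (k *: y) = k *: hinner x y;
  hinner_act : forall (x y : H) (a : A),
    hinner x (hact y a) = cmul (hinner x y) a;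
  hinner_star : forall x y : H, cstar (hinner x y) = hinner y x;
  hinner_positive : forall x : H, cpositive (hinner x x);
  hinner_eq0 : forall x : H, hinner x x = 0 -> x = 0;
  norm_hinner : forall x : H, `|x| ^+ 2 = `|hinner x x|
}.

#[short(type="hilbertModType")]
HB.structure Definition HilbertModule (R : realType) (A : cstarAlgType R) :=
  {H of isHilbertModule R A H & CompleteNormedModule R[i] H}.

Section AdjointableOperators.
Context (R : realType) (A : cstarAlgType R) (H : hilbertModType A).
Implicit Types T S P : H -> H.

Definition is_adjoint T S : Prop :=
  forall x y : H, hinner (T x) y = hinner x (S y) :> A.

(* Membership in L(H): an adjointable map is automatically C-linear, A-linear
   and bounded. *)
Definition adjointable T : Prop := exists S, is_adjoint T S.

Definition is_projection P : Prop := is_adjoint P P /\ P \o P =1 P.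

(* Positivity in the C*-algebra L(H), as in cpositive: T = B^* B. *)
Definition positive_op T : Prop :=
  exists B B', is_adjoint B B' /\ T =1 B' \o B.

(* S = T^(1/2): positive square roots in a C*-algebra are unique. *)
Definition is_sqrt_op T S : Prop := positive_op S /\ S \o S =1 T.

(* The norm of H takes its (real) values in R[i], whence the real part. *)
Definition opnorm T : \bar R :=
  ereal_sup [set (complex.Re `|T x|)%:E | x in [set x : H | `|x| <= 1]].

End AdjointableOperators.

(* Main.v *)
Require Import Defs.
From HB Require Import structures.
From mathcomp Require Import all_boot all_order all_algebra.
From mathcomp Require Import complex ring lra.
From mathcomp Require Import boolp classical_sets functions reals constructive_ereal ereal.
From mathcomp Require Import topology normedtype.

Set Implicit Arguments.
Unset Strict Implicit.
Unset Printing Implicit Defensive.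
Import Order.TTheory GRing.Theory Num.Theory.
Import numFieldNormedType.Exports.
Local Open Scope classical_set_scope.
Local Open Scope ring_scope.
Local Open Scope complex_scope.

(** Why the theorem is true.

    Two projections P and Q are, away from degenerate pieces, a family of pairs
    of lines at an angle theta, and tau = (P - Q)^2 is the operator sin(theta)^2;
    it commutes with P and Q. In the same picture P + Q has determinant tau, so
    that (P + Q)^(1/2) loses its inverse where theta tends to 0, and the
    equation (P + Q)^(1/2) X = P may fail to have an adjointable solution
    because the polar decomposition of (P - Q) P may fail to exist. Where theta
    is exactly 0 the two projections agree and the equation is harmless. Hence
    the perturbation: rotate Q towards P so that all the small angles become 0,
    which leaves a gap between the angle 0 and the other ones.

    Let N be the off-diagonal part of Q with respect to P. Then N^2 = tau - tau^2,
    P N + N P = N and Q = tau + (1 - 2 tau) P + N. If s and g are functions of tau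
    such that s (s g^2 (tau - tau^2) - s (1 - s^2)) = 0, the operator
      Q' = s^2 + (1 - 2 s^2) P + s g N
    is a projection with (P - Q')^2 = s^2, that is, s is the new sine. Under the
    slightly stronger relation
      s g^2 (tau - tau^2) = s - s^3
    everything is explicit: with f = (2 (1 + s))^(-1/2),
      S = (P + Q' + s) f  and  X = f ((1 + s) P - g N P)
    satisfy S^2 = P + Q' and S X = P. The bounded function g takes the place of
    cos(theta') / (sin(theta) cos(theta)) with theta' the new angle; it can be
    chosen bounded because s vanishes for small angles: with d = eta^2 the choice is
      s^2 = (tau - d)^+ / (1 - d),  g^2 = 1 / ((1 - d) max(tau, d))
    (lemma clipped_sine), and then Q - Q' has norm at most eta + 5 eta^2.

    All of this needs square roots, inverses and positive parts of functions of
    tau, together with norm estimates. They take place in the commutative ring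
    of the self-adjoint bounded elements of the bicommutant of tau. An element is
    called positive when it is a square in that ring. The two bridges between
    norm and positivity are elementary:
    - if F and C are commuting self-adjoint operators and F^2 + C^2 = c^2, then
      F + i C and F - i C are c times isometries, so that F has norm at most c
      (opbound_of_sqr);
    - if B has norm at most 1, then 1 - B has a square root, obtained as the
      limit of Y -> (B + Y^2) / 2, the convergence being controlled by the scalar
      iteration y -> (1 + y^2) / 2 (majorant_fixpoint, bicomm_sqrt_1B).
    Sums of positive elements are then positive by the triangle inequality
    (bposD), and positive parts exist (pos_neg_parts). *)

(** * The real-valued norm *)

Section RealNorm.
Context (R : realType) (V : normedModType R[i]).
Implicit Types (x y : V) (a r : R).

(** The norm of a complex normed module has its values in the complex field,
    whose order is partial; its real part lives in a totally ordered field. *)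
Definition nrm x : R := complex.Re `|x|.

Lemma nrmE x : `|x| = (nrm x)%:C.
Proof. by rewrite /nrm RRe_real ?normr_real. Qed.

Lemma nrm_ge0 x : 0 <= nrm x.
Proof. by rewrite -ler0c -nrmE. Qed.

Lemma nrmD x y : nrm (x + y) <= nrm x + nrm y.
Proof. by rewrite -lecR rmorphD /= -!nrmE ler_normD. Qed.

Lemma nrm0 : nrm (0 : V) = 0.
Proof. by rewrite /nrm normr0. Qed.

Lemma nrm_eq0 x : nrm x = 0 -> x = 0.
Proof. by move=> x0; apply/eqP; rewrite -normr_eq0 nrmE x0. Qed.

Lemma nrmZr r x : nrm (r%:C *: x) = `|r| * nrm x.
Proof.
apply/complexI; rewrite rmorphM /= -!nrmE normrZ normc_def /=.
by rewrite expr0n /= addr0 sqrtr_sqr.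
Qed.

Lemma nrmZi x : nrm ('i%C *: x) = nrm x.
Proof.
apply/complexI; rewrite -!nrmE normrZ normc_def /=.
by rewrite expr0n expr1n add0r sqrtr1 mul1r.
Qed.

Lemma nrmN x : nrm (- x) = nrm x.
Proof. by rewrite /nrm normrN. Qed.

Lemma nrmB x y z : nrm (x - z) <= nrm (x - y) + nrm (y - z).
Proof. by rewrite (le_trans _ (nrmD _ _))// addrA subrK. Qed.

Lemma nrm_small x (c : R) : (forall e : R, 0 < e -> nrm x <= c * e) -> x = 0.
Proof.
move=> h; apply: nrm_eq0; apply/eqP; rewrite eq_le nrm_ge0 andbT.
rewrite leNgt; apply/negP => x0.
have c0 : 0 < `|c| + 1 by rewrite ltr_wpDl.
have e0 : 0 < nrm x / (2 * (`|c| + 1)) by rewrite divr_gt0 // mulr_gt0.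
have := h _ e0.
apply/negP; rewrite -ltNge mulrA ltr_pdivrMr ?mulr_gt0 //.
rewrite mulrC ltr_pM2l //; have := ler_norm c; have := normr_ge0 c; lra.
Qed.

End RealNorm.

Lemma nrm_complete (R : realType) (V : completeNormedModType R[i]) (u : nat -> V) :
  (forall e : R, 0 < e -> exists n0, forall m n, (n0 <= m)%N -> (n0 <= n)%N ->
     nrm (u m - u n) < e) ->
  exists l, forall e : R, 0 < e -> exists n0, forall n, (n0 <= n)%N ->
    nrm (l - u n) < e.
Proof.
move=> hu.
have gt0E (e : R[i]) : 0 < e -> e = (complex.Re e)%:C /\ 0 < complex.Re e.
  move=> e0; have eE : e = (complex.Re e)%:C by rewrite RRe_real // gtr0_real.
  by split=> //; rewrite -ltcR -eE.
have : cauchy (u @ \oo).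
  apply/cauchy_ballP => e e0.
  have [eE e1] := gt0E _ e0.
  have [n0 hn0] := hu _ e1.
  exists ([set u n | n in [set n | (n0 <= n)%N]], [set u n | n in [set n | (n0 <= n)%N]]) => /=.
    by split; exists n0 => //= n n0n; exists n.
  move=> [_ _] /= [[m n0m <-] [n n0n <-]].
  by rewrite -ball_normE /ball_ /= nrmE eE ltcR hn0.
move/cauchy_cvg => /cvg_ex[l ul].
exists l => e e0.
have e0C : 0 < e%:C :> R[i] by rewrite ltcR.
have /cvgrPdist_lt/(_ _ e0C)[n0 _ h] := ul.
exists n0 => n n0n; have := h n n0n; rewrite /= nrmE ltcR.
by [].
Qed.
(** * The inner product *)

Section InnerProduct.
Context (R : realType) (A : cstarAlgType R) (H : hilbertModType A).
Implicit Types (x y z : H) (k : R[i]).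
Local Notation "<< x , y >>" := (hinner x y : A).

Lemma hinnerDl x y z : << x + y, z >> = << x, z >> + << y, z >>.
Proof. by rewrite -hinner_star hinnerDr cstarD !hinner_star. Qed.

Lemma hinnerZl k x y : << k *: x, y >> = k^*%C *: << x, y >>.
Proof. by rewrite -hinner_star hinnerZr cstarZ hinner_star. Qed.

Lemma hinnerNr x y : << x, - y >> = - << x, y >>.
Proof. by rewrite -scaleN1r hinnerZr scaleN1r. Qed.

Lemma hinnerNl x y : << - x, y >> = - << x, y >>.
Proof. by rewrite -hinner_star hinnerNr -scaleN1r cstarZ rmorphN1 scaleN1r hinner_star. Qed.

Lemma hinner_inj x y : (forall z, << z, x >> = << z, y >>) -> x = y.
Proof.
move=> xy; apply/eqP; rewrite -subr_eq0; apply/eqP; apply/(@hinner_eq0 R A).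
by rewrite hinnerDr hinnerNr xy subrr.
Qed.

Lemma nrm_hinner x : nrm << x, x >> = nrm x ^+ 2.
Proof. by apply: complexI; rewrite rmorphXn /= -!nrmE norm_hinner. Qed.

Lemma eq_nrm x y : << x, x >> = << y, y >> -> nrm x = nrm y.
Proof.
move=> /(congr1 (@nrm R A)); rewrite !nrm_hinner => /eqP.
by rewrite eqrXn2 ?nrm_ge0 // => /eqP.
Qed.

(** A rough Cauchy-Schwarz inequality, by polarization and the triangle inequality
    in H; it serves for the continuity of the inner product. *)
Lemma hinner_unit_bound x y : nrm x <= 1 -> nrm y <= 1 -> nrm << x, y >> <= 6%:R.
Proof.
move=> x1 y1.
have sym_bound (u v : H) : nrm u <= 1 -> nrm v <= 1 ->
    nrm (<< u, v >> + << v, u >>) <= 6%:R.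
  move=> u1 v1.
  have -> : << u, v >> + << v, u >> = << u + v, u + v >> - (<< u, u >> + << v, v >>).
    apply/eqP; rewrite eq_sym subr_eq !hinnerDl !hinnerDr; apply/eqP.
    by rewrite [LHS](AC (2*2) ((2*3)*(1*4))).
  have := nrmD << u + v, u + v >> (- (<< u, u >> + << v, v >>)).
  have := nrmD << u, u >> << v, v >>.
  rewrite nrmN !nrm_hinner.
  have := nrmD u v; have := nrm_ge0 u; have := nrm_ge0 v; have := nrm_ge0 (u + v).
  move: (nrm (_ - _)) (nrm (_ + <<v, v>>)) (nrm (u + v)) => p q r.
  nra.
have iy1 : nrm ('i%C *: y) <= 1 by rewrite nrmZi.
have -> : << x, y >> = (2^-1)%:C *:
    ((<< x, y >> + << y, x >>) - 'i%C *: (<< x, 'i%C *: y >> + << 'i%C *: y, x >>)).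
  have conji : ('i^*)%C = - 'i%C :> R[i] by apply/eqP; rewrite eq_complex /= oppr0 !eqxx.
  rewrite hinnerZr hinnerZl. rewrite conji -scaleNr [- 'i%C *: (_ + _)]scalerDr !(scalerA (- 'i%C)) mulNr -expr2 sqr_i.
  rewrite mulrNN -expr2 sqr_i opprK scale1r scaleN1r.
  have h2 : (2^-1)%:C * 2%:R = 1 :> R[i].
    by rewrite -(rmorph_nat (real_complex R) 2) -rmorphM /= mulVf ?pnatr_eq0.
  by rewrite addrACA subrr addr0 -mulr2n -[LHS]scale1r -h2 -scalerA scaler_nat.
rewrite nrmZr ger0_norm ?invr_ge0 //.
have := nrmD (<< x, y >> + << y, x >>) (- ('i%C *: (<< x, 'i%C *: y >> + << 'i%C *: y, x >>))).
rewrite nrmN nrmZi; have := sym_bound _ _ x1 y1; have := sym_bound _ _ x1 iy1.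
lra.
Qed.

Lemma hinner_bound x y a b : 0 < a -> 0 < b -> nrm x <= a -> nrm y <= b ->
  nrm << x, y >> <= 6%:R * a * b.
Proof.
move=> a0 b0 xa yb.
have xE : x = a%:C *: (a^-1%:C *: x).
  by rewrite scalerA -rmorphM /= divff ?gt_eqF // scale1r.
have yE : y = b%:C *: (b^-1%:C *: y).
  by rewrite scalerA -rmorphM /= divff ?gt_eqF // scale1r.
rewrite xE yE hinnerZl hinnerZr conjc_real !nrmZr !gtr0_norm //.
rewrite (_ : 6%:R * a * b = (a * b) * 6%:R); last by ring.
rewrite mulrA ler_pM2l ?mulr_gt0 // hinner_unit_bound // nrmZr gtr0_norm ?invr_gt0 //.
  by rewrite mulrC ler_pdivrMr ?mul1r.
by rewrite mulrC ler_pdivrMr ?mul1r.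
Qed.

End InnerProduct.

(** * Self-adjoint operators and their bounds *)

Section SelfAdjoint.
Context (R : realType) (A : cstarAlgType R) (H : hilbertModType A).
Implicit Types (x y z : H) (k : R[i]) (T S F C : H -> H) (c : R).

Definition selfadjoint T := is_adjoint T T.

Definition opbound T c := forall x, nrm (T x) <= c * nrm x.

Lemma adjointD T S x y : is_adjoint T S -> T (x + y) = T x + T y.
Proof.
move=> hT; apply: hinner_inj => z.
by rewrite -hinner_star hT -[RHS]hinner_star !hinnerDl !hT.
Qed.

Lemma adjointZ T S k x : is_adjoint T S -> T (k *: x) = k *: T x.
Proof.
move=> hT; apply: hinner_inj => z.
by rewrite -hinner_star hT -[RHS]hinner_star !hinnerZl !hT.
Qed.

Lemma adjointN T S x : is_adjoint T S -> T (- x) = - T x.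
Proof. by move=> hT; rewrite -scaleN1r (adjointZ _ _ hT) scaleN1r. Qed.

Lemma adjointB T S x y : is_adjoint T S -> T (x - y) = T x - T y.
Proof. by move=> hT; rewrite (adjointD _ _ hT) (adjointN _ hT). Qed.

(** The operators F + k C with k = i or k = - i multiply the norm by c, because
    (F + k C)^* (F + k C) = F^2 + C^2, and F is their half-sum. *)
Lemma opbound_of_sqr F C c : 0 <= c -> selfadjoint F -> selfadjoint C ->
  (forall x, F (C x) = C (F x)) ->
  (forall x, F (F x) + C (C x) = (c ^+ 2)%:C *: x) -> opbound F c.
Proof.
move=> c0 hF hC FC FFCC x.
have key k : (k^*)%C = - k -> k * k = - 1 -> nrm (F x + k *: C x) = c * nrm x.
  move=> kJ kk; rewrite -[c]ger0_norm // -nrmZr; apply: (@eq_nrm R A H).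
  rewrite !hinnerDl !hinnerDr !hinnerZl !hinnerZr !hF !hC FC conjc_real.
  rewrite !scalerA kJ mulNr kk opprK scale1r -expr2 -rmorphXn /= -[RHS]hinnerZr -FFCC hinnerDr.
  by rewrite -addrA; congr (_ + _); rewrite addrA -scalerDl subrr scale0r add0r.
have i1 : ('i^*)%C = - 'i%C :> R[i] by apply/eqP; rewrite eq_complex /= oppr0 !eqxx.
have i2 : ((- 'i)^*)%C = - - 'i%C :> R[i] by apply/eqP; rewrite eq_complex /= !oppr0 opprK !eqxx.
have k1 := key _ i1 (sqr_i R).
have k2 : nrm (F x + - 'i%C *: C x) = c * nrm x by apply: key => //; rewrite mulrNN; apply: sqr_i.
have := nrmD (F x + 'i%C *: C x) (F x + - 'i%C *: C x).
rewrite addrACA -scalerDl subrr scale0r addr0 k1 k2.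
have -> : F x + F x = (2%:R)%:C *: F x by rewrite (rmorph_nat (real_complex R) 2) scaler_nat mulr2n.
by rewrite nrmZr ger0_norm //; lra.
Qed.

End SelfAdjoint.

(** * The commutative ring of functions of a self-adjoint operator *)

Section Bicommutant.
Context (R : realType) (A : cstarAlgType R) (H : hilbertModType A).
Implicit Types (T : H -> H).

Definition bounded_op T := exists c : R, opbound T c.

Record saop := SAOp {
  saop_op :> H -> H;
  saop_selfadjoint : selfadjoint saop_op;
  saop_bounded : bounded_op saop_op }.

(** Self-adjoint bounded operators that commute with all self-adjoint bounded
    operators that commute with t. Since t commutes with itself, these operators
    commute with t, hence with one another: they form a commutative ring, which
    is closed under the limits that define square roots and inverses. *)
Definition in_bicommutant (t : saop) : {pred H -> H} := fun T =>
  `[< [/\ selfadjoint T, bounded_op T & forall W : saop,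
        (forall x, W (t x) = t (W x)) -> forall x, W (T x) = T (W x)] >].

Record bicommutant t := Bicommutant {
  bicomm_op :> H -> H;
  bicomm_opP : bicomm_op \in in_bicommutant t }.

HB.instance Definition _ t := [isSub for @bicomm_op t].
HB.instance Definition _ t := [Choice of bicommutant t by <:].

Lemma opbound_wf T c : opbound T c -> opbound T `|c|.
Proof.
by move=> h x; apply: (le_trans (h x)); rewrite ler_wpM2r ?nrm_ge0 ?ler_norm.
Qed.

Context (t : saop).
Implicit Types (Z : bicommutant t) (W : saop).

Lemma bicommP Z : [/\ selfadjoint Z, bounded_op Z & forall W,
  (forall x, W (t x) = t (W x)) -> forall x, W (Z x) = Z (W x)].
Proof. by case: Z => T /= /asboolP. Qed.

Lemma bicomm_selfadjoint Z : selfadjoint Z. Proof. by case: (bicommP Z). Qed.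
Lemma bicomm_bounded Z : bounded_op Z. Proof. by case: (bicommP Z). Qed.

Lemma bicomm_commute Z W :
  (forall x, W (t x) = t (W x)) -> forall x, W (Z x) = Z (W x).
Proof. by case: (bicommP Z) => _ _; apply. Qed.

Lemma bicomm_zmod_closed : zmod_closed (in_bicommutant t).
Proof.
split.
  apply/asboolP; split.
  - move=> x y; change (hinner (0 : H) y = hinner x (0 : H) :> A).
    by rewrite -(scale0r (0 : H)) hinnerZl hinnerZr conjc0 !scale0r.
  - exists 0 => x; change (nrm (0 : H) <= 0 * nrm x).
    by rewrite nrm0 mul0r.
  - move=> W _ x; change (W (0 : H) = 0).
    by rewrite -(scale0r (0 : H)) (adjointZ _ _ (saop_selfadjoint W)) !scale0r.
move=> T1 T2 /asboolP[s1 [c1 b1] h1] /asboolP[s2 [c2 b2] h2]; apply/asboolP; split.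
- move=> x y; change (hinner (T1 x - T2 x) y = hinner x (T1 y - T2 y) :> A).
  by rewrite hinnerDl hinnerDr hinnerNl hinnerNr s1 s2.
- exists (c1 + c2) => x; change (nrm (T1 x - T2 x) <= (c1 + c2) * nrm x).
  by rewrite (le_trans (nrmD _ _)) // nrmN mulrDl lerD.
- move=> W Wt x; change (W (T1 x - T2 x) = T1 (W x) - T2 (W x)).
  rewrite (adjointB _ _ (saop_selfadjoint W)). by rewrite (h1 W) ?(h2 W).
Qed.

HB.instance Definition _ := GRing.isZmodClosed.Build (H -> H) (in_bicommutant t) bicomm_zmod_closed.
HB.instance Definition _ := [SubChoice_isSubZmodule of bicommutant t by <:].

Lemma bicommD Z1 Z2 x : (Z1 + Z2) x = Z1 x + Z2 x. Proof. by []. Qed.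
Lemma bicommN Z x : (- Z) x = - Z x. Proof. by []. Qed.
Lemma bicomm0 x : (0 : bicommutant t) x = 0. Proof. by []. Qed.

Lemma bicomm_eq Z1 Z2 : Z1 =1 Z2 -> Z1 = Z2.
Proof. by move=> /funext Z12; apply: val_inj. Qed.

Definition bicomm_saop Z := SAOp (bicomm_selfadjoint Z) (bicomm_bounded Z).

(** Z1 commutes with t, as t does, and therefore with Z2. *)
Lemma bicommC Z1 Z2 x : Z1 (Z2 x) = Z2 (Z1 x).
Proof.
by apply: (bicomm_commute Z2 (W := bicomm_saop Z1)) => {}x /=; rewrite -(bicomm_commute Z1).
Qed.

Lemma bicomm_mul_subproof Z1 Z2 : (Z1 \o Z2) \in in_bicommutant t.
Proof.
apply/asboolP; split.
- by move=> x y /=; rewrite !bicomm_selfadjoint bicommC.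
- have [c1 b1] := bicomm_bounded Z1; have [c2 b2] := bicomm_bounded Z2.
  exists (`|c1| * c2) => x /=; rewrite (le_trans (opbound_wf b1 _)) // -mulrA.
  by rewrite ler_wpM2l.
- by move=> W Wt x /=; rewrite !(bicomm_commute _ Wt).
Qed.

Definition bicomm_mul Z1 Z2 := Bicommutant (bicomm_mul_subproof Z1 Z2).

Lemma const_subproof (r : R) : (fun x : H => r%:C *: x) \in in_bicommutant t.
Proof.
apply/asboolP; split.
- by move=> x y /=; rewrite hinnerZl hinnerZr conjc_real.
- by exists `|r| => x; rewrite nrmZr.
- by move=> W Wt x /=; rewrite (adjointZ _ _ (saop_selfadjoint W)).
Qed.

Definition const (r : R) := Bicommutant (const_subproof r).

Lemma bicomm_id_subproof : @id H \in in_bicommutant t.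
Proof.
apply/asboolP; split=> //.
by exists 1 => x; rewrite mul1r.
Qed.

Let bicomm_one := Bicommutant bicomm_id_subproof.

Let bicomm_mulA : associative bicomm_mul.
Proof. by move=> Z1 Z2 Z3; apply: bicomm_eq. Qed.
Let bicomm_mulC : commutative bicomm_mul.
Proof. by move=> Z1 Z2; apply: bicomm_eq => x; apply: bicommC. Qed.
Let bicomm_mul1 : left_id bicomm_one bicomm_mul.
Proof. by move=> Z; apply: bicomm_eq. Qed.
Let bicomm_mulDl : left_distributive bicomm_mul +%R.
Proof. by move=> Z1 Z2 Z3; apply: bicomm_eq. Qed.

HB.instance Definition _ := GRing.Zmodule_isComPzRing.Build (bicommutant t)
  bicomm_mulA bicomm_mulC bicomm_mul1 bicomm_mulDl.

Lemma bicommM Z1 Z2 x : (Z1 * Z2) x = Z1 (Z2 x). Proof. by []. Qed.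
Lemma bicomm1 x : (1 : bicommutant t) x = x. Proof. by []. Qed.

Lemma const_is_zmod_morphism : zmod_morphism const.
Proof. by move=> r s; apply: bicomm_eq => x; rewrite bicommD /= rmorphB /= scalerBl. Qed.

Lemma const_is_monoid_morphism : monoid_morphism const.
Proof.
split; first by apply: bicomm_eq => x /=; rewrite scale1r.
by move=> r s; apply: bicomm_eq => x; rewrite bicommM /= rmorphM /= scalerA.
Qed.

HB.instance Definition _ := GRing.isZmodMorphism.Build R (bicommutant t) const const_is_zmod_morphism.
HB.instance Definition _ := GRing.isMonoidMorphism.Build R (bicommutant t) const const_is_monoid_morphism.

Lemma const_half : 2%:R * const 2^-1 = 1.
Proof. by rewrite -(rmorph_nat const) -rmorphM /= mulfV ?rmorph1 ?pnatr_eq0. Qed.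

End Bicommutant.

(** * Completeness of the bicommutant *)

Section Convergence.
Context (R : realType) (A : cstarAlgType R) (H : hilbertModType A) (t : saop H).
Implicit Types (Z Y B : bicommutant t) (W : saop H) (c d e y : R).

Lemma opbound_le (T : H -> H) c d : c <= d -> opbound T c -> opbound T d.
Proof. by move=> cd h x; rewrite (le_trans (h x)) // ler_wpM2r ?nrm_ge0. Qed.

Lemma opboundD (T1 T2 : H -> H) c1 c2 : opbound T1 c1 -> opbound T2 c2 ->
  opbound (fun x => T1 x + T2 x) (c1 + c2).
Proof. by move=> h1 h2 x; rewrite (le_trans (nrmD _ _)) // mulrDl lerD. Qed.

Lemma opboundN (T : H -> H) c : opbound T c -> opbound (fun x => - T x) c.
Proof. by move=> h x; rewrite nrmN. Qed.

Lemma opboundM Z1 Z2 c1 c2 : 0 <= c1 ->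
  opbound Z1 c1 -> opbound Z2 c2 -> opbound (Z1 * Z2) (c1 * c2).
Proof.
by move=> c0 h1 h2 x; rewrite bicommM (le_trans (h1 _)) // -mulrA ler_wpM2l.
Qed.

Lemma opbound_const c : 0 <= c -> opbound (const t c) c.
Proof. by move=> c0 x; rewrite nrmZr ger0_norm. Qed.

Lemma opbound_subC Z1 Z2 c : opbound (Z1 - Z2) c -> opbound (Z2 - Z1) c.
Proof. by rewrite -[Z2 - Z1]opprB => /opboundN. Qed.

Lemma opbound_sub_trans Z2 Z1 Z3 c d :
  opbound (Z1 - Z2) c -> opbound (Z2 - Z3) d -> opbound (Z1 - Z3) (c + d).
Proof. by move=> h1 h2; have := opboundD h1 h2; rewrite -[Z1 - Z3](subrKA Z2). Qed.

Lemma bicomm_eq_small Z1 Z2 c :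
  (forall e, 0 < e -> opbound (Z1 - Z2) (c * e)) -> Z1 = Z2.
Proof.
move=> h; apply: bicomm_eq => x; apply/eqP; rewrite -subr_eq0; apply/eqP.
apply: (@nrm_small _ _ _ (c * nrm x)) => e e0.
by rewrite mulrAC; apply: (h e).
Qed.

(** A Cauchy sequence converges pointwise in H, uniformly on the unit ball; the
    limit is self-adjoint since the inner product is continuous, and it commutes
    with the bounded operators W of the definition of the bicommutant. *)
Lemma bicomm_complete (Zn : nat -> bicommutant t) :
  (forall e, 0 < e -> exists n0, forall m n, (n0 <= m)%N -> (n0 <= n)%N ->
     opbound (Zn m - Zn n) e) ->
  exists Z, forall e, 0 < e -> exists n0, forall n, (n0 <= n)%N ->
    opbound (Z - Zn n) e.
Proof.
move=> hZ.
have hlim x : exists l, forall e, 0 < e -> exists n0, forall n, (n0 <= n)%N ->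
    nrm (l - Zn n x) < e.
  apply: nrm_complete => e e0.
  have x1 : 0 < nrm x + 1 by rewrite ltr_wpDl ?nrm_ge0.
  have [n0 hn0] := hZ _ (divr_gt0 e0 x1).
  exists n0 => m n n0m n0n; have := hn0 m n n0m n0n x.
  move/le_lt_trans; apply; rewrite mulrAC ltr_pdivrMr // ltr_pM2l // ltrDl //.
have [f hf] := choice hlim.
have fZ e : 0 < e -> exists n0, forall n, (n0 <= n)%N ->
    opbound (fun x => f x - Zn n x) e.
  move=> e0; have [n0 hn0] := hZ _ e0; exists n0 => n n0n x.
  apply/ler_addgt0Pr => d d0; have [n1 hn1] := hf x _ d0.
  have := hn1 (maxn n0 n1) (leq_maxr _ _).
  have := hn0 (maxn n0 n1) n (leq_maxl _ _) n0n x.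
  have := nrmB (f x) (Zn (maxn n0 n1) x) (Zn n x).
  rewrite bicommD bicommN; lra.
have approx c : 0 < c -> exists Z, opbound (fun z => f z - Z z) c.
  by move=> c0; have [n0 /(_ _ (leqnn _)) ?] := fZ _ c0; exists (Zn n0).
have f_in : f \in in_bicommutant t.
  apply/asboolP; split.
  - move=> x y; apply/eqP; rewrite -subr_eq0; apply/eqP.
    have x1 : 0 < nrm x + 1 by rewrite ltr_wpDl ?nrm_ge0.
    have y1 : 0 < nrm y + 1 by rewrite ltr_wpDl ?nrm_ge0.
    apply: (@nrm_small _ _ _ (12%:R * (nrm x + 1) * (nrm y + 1))) => e e0.
    have [Z hZe] := approx e e0.
    have -> : hinner (f x) y - hinner x (f y) =
        hinner (f x - Z x) y - hinner x (f y - Z y) :> A.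
      rewrite hinnerDl hinnerDr hinnerNl hinnerNr (bicomm_selfadjoint Z).
      by rewrite opprB addrA subrK.
    rewrite (le_trans (nrmD _ _)) // nrmN.
    have := hinner_bound (mulr_gt0 e0 x1) y1 (x := f x - Z x) (y := y).
    have := hinner_bound x1 (mulr_gt0 e0 y1) (x := x) (y := f y - Z y).
    have hx := hZe x; have hy := hZe y.
    have ex : 0 <= e by exact: ltW.
    have nx1 : nrm x <= nrm x + 1 by rewrite lerDl.
    have ny1 : nrm y <= nrm y + 1 by rewrite lerDl.
    move=> /(_ nx1 (le_trans hy (ler_wpM2l ex ny1))) b1.
    move=> /(_ (le_trans hx (ler_wpM2l ex nx1)) ny1) b2.
    apply: (le_trans (lerD b2 b1)); rewrite le_eqVlt; apply/orP; left; apply/eqP; ring.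
  - have [Z hZe] := approx 1 ltr01; have [c hc] := bicomm_bounded Z.
    exists (1 + c) => x; have := opboundD hZe hc; move/(_ x); by rewrite subrK.
  - move=> W Wt x; apply/eqP; rewrite -subr_eq0; apply/eqP.
    have [c hc] := saop_bounded W.
    apply: (@nrm_small _ _ _ (`|c| * nrm x + nrm (W x))) => e e0.
    have [Z hZe] := approx e e0.
    have -> : W (f x) - f (W x) = W (f x - Z x) - (f (W x) - Z (W x)).
      rewrite (adjointB _ _ (saop_selfadjoint W)) (bicomm_commute Z Wt).
      by rewrite opprB addrA subrK.
    rewrite (le_trans (nrmD _ _)) // nrmN mulrDl lerD //; last by rewrite mulrC; apply: hZe.
    by rewrite (le_trans (opbound_wf hc _)) // -mulrA ler_wpM2l // mulrC; apply: hZe.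
by exists (Bicommutant f_in).
Qed.

End Convergence.

(** * Square roots and inverses by iteration *)

Section FixedPoint.
Context (R : realType) (A : cstarAlgType R) (H : hilbertModType A) (t : saop H).
Implicit Types (Z Y B : bicommutant t) (c d e y : R).

(** Kantorovich's majorant principle: if the increments of the iterates of Phi are
    bounded by those of a bounded increasing scalar iteration, they are summable.
    This applies to maps that are not contractions. *)
Lemma majorant_fixpoint (Phi : bicommutant t -> bicommutant t) (phi : R -> R) (M K : R) :
  0 <= M -> 0 <= phi 0 -> opbound (Phi 0) (phi 0) ->
  (forall y, 0 <= y -> y <= M -> phi y <= M) ->
  (forall (Y Y' : bicommutant t) y y', 0 <= y' -> y' <= y -> y <= M ->
     opbound Y y -> opbound Y' y' -> opbound (Y - Y') (y - y') ->
     phi y' <= phi y /\ opbound (Phi Y - Phi Y') (phi y - phi y')) ->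
  (forall (Y Y' : bicommutant t) e, opbound Y M -> opbound Y' M -> opbound (Y - Y') e ->
     opbound (Phi Y - Phi Y') (K * e)) ->
  exists2 Y : bicommutant t, opbound Y M & Phi Y = Y.
Proof.
move=> M0 phi00 Phi0 phiM step lip.
pose y n := iter n phi 0; pose Yn n := iter n Phi 0.
have inv n : [/\ 0 <= y n, y n <= y n.+1, y n.+1 <= M, opbound (Yn n) (y n) &
    opbound (Yn n.+1 - Yn n) (y n.+1 - y n)].
  elim: n => [|n [y0 y1 y2 b1 b2]].
    split=> //; first exact: phiM.
      by move=> x; rewrite bicomm0 nrm0 mul0r.
    by rewrite !subr0.
  have b3 : opbound (Yn n.+1) (y n.+1).
    by have := opboundD b1 b2; under eq_fun do rewrite bicommD bicommN addrCA subrr addr0;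
       rewrite addrCA subrr addr0.
  have y1' := le_trans y0 y1.
  have [? ?] := step _ _ _ _ y0 y1 y2 b3 b1 b2.
  by split=> //; apply: phiM.
have mono m n : (n <= m)%N -> y n <= y m /\ opbound (Yn m - Yn n) (y m - y n).
  move=> /subnK <-; elim: (m - n)%N => [|k [IH1 IH2]].
    by rewrite add0n !subrr; split=> // x; rewrite bicomm0 nrm0 mul0r.
  have [_ h1 _ _ h2] := inv (k + n)%N; rewrite addSn; split; first exact: le_trans h1.
  by have := opbound_sub_trans h2 IH2; rewrite addrA subrK.
pose E : set R := range y.
have Esup : has_sup E.
  split; first by exists (y 0), 0.
  by exists M => _ [n _ <-]; have [_ h1 h2 _ _] := inv n; apply: le_trans h2.
have yE n : y n <= sup E by apply: ub_le_sup; [case: Esup | exists n].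
have [Z hZ] : exists Z, forall e, 0 < e -> exists n0, forall n, (n0 <= n)%N ->
    opbound (Z - Yn n) e.
  apply: bicomm_complete => e e0.
  have [_ [n0 _ <-] hn0] := sup_adherent e0 Esup.
  have key m n : (n0 <= n)%N -> (n <= m)%N -> opbound (Yn m - Yn n) e.
    move=> n0n nm; have [_] := mono _ _ nm; apply: opbound_le.
    have := yE m; have [+ _] := mono _ _ n0n; lra.
  exists n0 => m n n0m n0n; case: (leqP n m) => [nm|/ltnW mn]; first exact: key.
  exact/opbound_subC/key.
have bZ : opbound Z M.
  move=> x; apply/ler_addgt0Pr => e e0.
  have nx : 0 < nrm x + 1 by rewrite ltr_wpDl ?nrm_ge0.
  have [n /(_ _ (leqnn n)) hn] := hZ _ (divr_gt0 e0 nx).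
  have [y0 y1 y2 b1 _] := inv n.
  have := opboundD (opbound_le (le_trans y1 y2) b1) hn x.
  rewrite bicommD bicommN addrCA subrr addr0 mulrDl => /le_trans; apply.
  rewrite lerD2l mulrAC ler_pdivrMr // ler_wpM2l ?(ltW e0) //.
  by rewrite lerDl.
exists Z => //; apply: (@bicomm_eq_small _ _ _ _ _ _ (K + 1)) => e e0.
have [n0 hn0] := hZ _ e0.
have [y0 y1 y2 b1 _] := inv n0.
have h1 := lip _ _ _ bZ (opbound_le (le_trans y1 y2) b1) (hn0 _ (leqnn _)).
have := opbound_sub_trans h1 (opbound_subC (hn0 _ (leqnSn _))).
by rewrite mulrDl mul1r.
Qed.

(** The solution Y of Y = (B + Y^2) / 2 satisfies (1 - Y)^2 = 1 - B. The iterates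
    of the majorant y -> (1 + y^2) / 2 from 0 increase and stay below its fixed
    point 1, although its derivative there is 1; so B may have norm exactly 1. *)
Lemma bicomm_sqrt_1B B : opbound B 1 ->
  exists2 Y : bicommutant t, opbound Y 1 & (1 - Y) * (1 - Y) = 1 - B.
Proof.
move=> B1; pose h := const t 2^-1.
have h2 : 2%:R * h = 1 by exact: const_half.
have bh : opbound h 2^-1 by apply: opbound_const; rewrite invr_ge0.
have half0 : 0 <= 2^-1 :> R by rewrite invr_ge0.
have [] := @majorant_fixpoint (fun Y => h * (B + Y * Y)) (fun y => 2^-1 * (1 + y * y)) 1 1.
- by [].
- by rewrite mul0r addr0 mulr1.
- rewrite !mul0r !addr0; exact: opboundM.
- by move=> y; nra.
- move=> Y Y' y y' y'0 y'y y1 bY bY' bD; split; first nra.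
  have -> : h * (B + Y * Y) - h * (B + Y' * Y') = h * ((Y - Y') * (Y + Y')) by ring.
  have -> : 2^-1 * (1 + y * y) - 2^-1 * (1 + y' * y') = 2^-1 * ((y - y') * (y + y')) by ring.
  apply: opboundM => //; apply: opboundM; rewrite ?subr_ge0 //; exact: opboundD.
- move=> Y Y' e bY bY' bD.
  have -> : h * (B + Y * Y) - h * (B + Y' * Y') = h * ((Y + Y') * (Y - Y')) by ring.
  have -> : 1 * e = 2^-1 * ((1 + 1) * e) by field.
  apply: opboundM => //; apply: opboundM => //; exact: opboundD.
move=> Y bY YE; exists Y => //.
have : 2%:R * Y = B + Y * Y by rewrite -[in LHS]YE mulrA h2 mul1r.
move=> YE2.
have -> : (1 - Y) * (1 - Y) = 1 - 2%:R * Y + Y * Y by ring.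
rewrite YE2; ring.
Qed.

(** The Neumann series, as the iteration of Y -> 1 + B Y. *)
Lemma bicomm_inv_1B B (b : R) : 0 <= b -> b < 1 -> opbound B b ->
  exists Y, (1 - B) * Y = 1.
Proof.
move=> b0 b1 bB.
have b1' : 0 < 1 - b by rewrite subr_gt0.
have [] := @majorant_fixpoint (fun Y => 1 + B * Y) (fun y => 1 + b * y) (1 - b)^-1 b.
- by rewrite invr_ge0 ltW.
- by rewrite mulr0 addr0.
- by rewrite !mulr0 !addr0 => x; rewrite bicomm1 mul1r.
- move=> y y0 yb; apply: (@le_trans _ _ (1 + b * (1 - b)^-1)).
    by rewrite lerD2l ler_wpM2l.
  rewrite le_eqVlt; apply/orP; left; apply/eqP; field; by rewrite gt_eqF.
- move=> Y Y' y y' y'0 y'y y1 bY bY' bD; split; first by rewrite lerD2l ler_wpM2l.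
  have -> : 1 + B * Y - (1 + B * Y') = B * (Y - Y') by ring.
  have -> : 1 + b * y - (1 + b * y') = b * (y - y') by ring.
  exact: opboundM.
- move=> Y Y' e bY bY' bD.
  have -> : 1 + B * Y - (1 + B * Y') = B * (Y - Y') by ring.
  exact: opboundM.
by move=> Y _ YE; exists Y; rewrite mulrBl mul1r -{1}YE addrK.
Qed.

End FixedPoint.

(** * Positivity in the bicommutant *)

Section Positivity.
Context (R : realType) (A : cstarAlgType R) (H : hilbertModType A) (t : saop H).
Implicit Types (Z Y B F C W y n a : bicommutant t) (c m : R).

Definition bpos Z := exists F, Z = F * F.

Lemma bpos_sqr F : bpos (F * F). Proof. by exists F. Qed.

Lemma bposM Z W : bpos Z -> bpos W -> bpos (Z * W).
Proof. by move=> [F ->] [C ->]; exists (F * C); ring. Qed.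

Lemma bpos_const c : 0 <= c -> bpos (const t c).
Proof.
by move=> c0; exists (const t (Num.sqrt c)); rewrite -rmorphM -expr2 /= sqr_sqrtr.
Qed.

Lemma bpos1 : bpos 1. Proof. by exists 1; rewrite mulr1. Qed.

Lemma bicomm_opbound_of_sqr Z c : 0 <= c -> bpos (const t (c ^+ 2) - Z * Z) ->
  opbound Z c.
Proof.
move=> c0 [F FE]; apply: (opbound_of_sqr (C := F)) => //; try exact: bicomm_selfadjoint.
  by move=> x; rewrite bicommC.
by move=> x; rewrite -!bicommM -bicommD -FE addrC subrK.
Qed.

Lemma sqr_add_eq0 F C : F * F + C * C = 0 -> F = 0.
Proof.
move=> FC; apply: (@bicomm_eq_small _ _ _ _ _ _ 0) => e e0; rewrite mul0r subr0.
apply: (bicomm_opbound_of_sqr (lexx 0)); exists C; rewrite expr2 mul0r rmorph0.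
by apply/eqP; rewrite subr_eq addrC FC.
Qed.

Lemma sqr_eq0 F : F * F = 0 -> F = 0.
Proof. by move=> F0; apply: (@sqr_add_eq0 F 0); rewrite F0 mulr0 addr0. Qed.

(** In terms of an angle with F = sin(phi), this is |cos(2 phi)| <= 1: indeed
    (1 - 2 F^2)^2 + (2 F C)^2 = 1 for C the square root of 1 - F^2. *)
Lemma opbound_1B_sqr F : opbound F 1 -> opbound (1 - 2%:R * (F * F)) 1.
Proof.
move=> bF; have bF2 : opbound (F * F) 1 by rewrite -[1]mulr1; apply: opboundM.
have [Y _ YE] := bicomm_sqrt_1B bF2.
apply: bicomm_opbound_of_sqr => //; exists (2%:R * F * (1 - Y)).
rewrite expr1n rmorph1.
transitivity (4%:R * (F * F) * (1 - F * F)); first by ring.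
by rewrite -YE; ring.
Qed.

(** Together with its converse opbound_1B_sqrt, a description of positivity by a
    norm inequality that is stable under sums. *)
Lemma bpos_opbound_1B Z : bpos Z ->
  exists2 m0, 0 < m0 & forall m, 0 < m -> m <= m0 -> opbound (1 - const t m * Z) 1.
Proof.
move=> [F ->]; have [c bc] := bicomm_bounded F.
pose d := `|c| + 1; have d0 : 0 < d by rewrite ltr_wpDl.
have bd : opbound F d by apply: (opbound_le _ (opbound_wf bc)); rewrite lerDl.
exists (2%:R / d ^+ 2); first by rewrite divr_gt0 // exprn_gt0.
move=> m m0 md; pose s := Num.sqrt (m / 2%:R).
have s2 : s ^+ 2 = m / 2%:R by rewrite sqr_sqrtr // divr_ge0 // ltW.
have sd1 : s * d <= 1.
  rewrite -(@ler_pXn2r _ 2) // ?nnegrE ?mulr_ge0 ?sqrtr_ge0 ?(ltW d0) //.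
  rewrite exprMn s2 expr1n mulrAC ler_pdivrMr // mul1r -ler_pdivlMr // exprn_gt0 //.
have -> : 1 - const t m * (F * F) = 1 - 2%:R * ((const t s * F) * (const t s * F)).
  have -> : const t m = 2%:R * (const t s * const t s).
    rewrite -rmorphM -expr2 s2 -(rmorph_nat (const t)) -rmorphM; apply: congr1; by field.
  ring.
  apply: opbound_1B_sqr; apply: (opbound_le sd1); apply: opboundM => //.
  exact: sqrtr_ge0.
exact/opbound_const/sqrtr_ge0.
Qed.

Lemma opbound_1B_sqrt Z m : 0 < m -> opbound (1 - const t m * Z) 1 ->
  exists2 Y : bicommutant t, opbound Y 1 &
    Z = (const t (Num.sqrt m)^-1 * (1 - Y)) * (const t (Num.sqrt m)^-1 * (1 - Y)).
Proof.
move=> m0 /bicomm_sqrt_1B [Y bY YE].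
exists Y => //.
rewrite mulrACA YE subKr mulrA -!rmorphM /=.
suff -> : (Num.sqrt m)^-1 * (Num.sqrt m)^-1 * m = 1 by rewrite rmorph1 mul1r.
by rewrite -invfM -expr2 sqr_sqrtr ?ltW // mulVf // gt_eqF.
Qed.

Lemma bpos_1B Y : opbound Y 1 -> bpos (1 - Y).
Proof.
move=> bY; have [|Y' _ YE] := @opbound_1B_sqrt (1 - Y) 1 ltr01.
  by rewrite rmorph1 mul1r subKr.
by rewrite YE; apply: bpos_sqr.
Qed.

Lemma bpos_sqrt Z : bpos Z -> exists2 F, bpos F & F * F = Z.
Proof.
move=> /bpos_opbound_1B[m m0 /(_ _ m0 (lexx _)) /(opbound_1B_sqrt m0)].
move=> [Y bY ->]; eexists; last by reflexivity.
by apply: bposM; [apply/bpos_const; rewrite invr_ge0 sqrtr_ge0 | exact: bpos_1B].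
Qed.

(** For a common small m, the operator 1 - (m / 2) (Z + W) is the half-sum of
    1 - m Z and 1 - m W, which have norm at most 1. *)
Lemma bposD Z W : bpos Z -> bpos W -> bpos (Z + W).
Proof.
move=> /bpos_opbound_1B[m1 m10 h1] /bpos_opbound_1B[m2 m20 h2].
pose m := Num.min m1 m2; have m0 : 0 < m by rewrite lt_min m10.
have := opboundD (h1 m m0 _) (h2 m m0 _).
rewrite !ge_min !lexx orbT => /(_ isT isT) b.
have [||Y _ ->] := @opbound_1B_sqrt (Z + W) (2^-1 * m); last exact: bpos_sqr.
  by rewrite mulr_gt0 ?invr_gt0.
have -> : 1 - const t (2^-1 * m) * (Z + W) =
    const t 2^-1 * ((1 - const t m * Z) + (1 - const t m * W)).
  by rewrite -[X in X - _](const_half t) rmorphM; ring.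
have h0 : 0 <= 2^-1 :> R by rewrite invr_ge0.
apply: (opbound_le (c := 2^-1 * (1 + 1))); first by lra.
by apply: opboundM => //; apply: opbound_const.
Qed.

(** After multiplication by m, c + Z is m c + 1 minus the contraction 1 - m Z. The
    inverse G is positive because it is the product of c + Z and of G^2. *)
Lemma bpos_inv Z c : 0 < c -> bpos Z -> exists2 G, bpos G & (const t c + Z) * G = 1.
Proof.
move=> c0 pZ; have [m m0 /(_ _ m0 (lexx _)) bm] := bpos_opbound_1B pZ.
have k0 : 0 < m * c + 1 by rewrite ltr_wpDl // mulr_ge0 // ltW.
pose b := (m * c + 1)^-1.
have b0 : 0 < b by rewrite invr_gt0.
have [|||Y YE] := @bicomm_inv_1B _ _ _ t (const t b * (1 - const t m * Z)) b.
- exact: ltW.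
- by rewrite invf_lt1 // ltrDr mulr_gt0.
- rewrite -[X in opbound _ X]mulr1; apply: opboundM => //; first exact: ltW.
  by apply: opbound_const; apply: ltW.
have inv : (const t c + Z) * (const t (m * b) * Y) = 1.
  rewrite -[RHS]YE mulrA; congr (_ * _).
  have bE : const t ((m * c + 1) * b) = 1 by rewrite mulfV ?gt_eqF // rmorph1.
  by rewrite -[X in _ = X - _]bE !(rmorphM, rmorphD) /= rmorph1; ring.
exists (const t (m * b) * Y) => //.
have -> : const t (m * b) * Y =
   (const t c + Z) * ((const t (m * b) * Y) * (const t (m * b) * Y)).
  by rewrite mulrA inv mul1r.
apply: bposM; last exact: bpos_sqr.
by apply: bposD => //; apply: bpos_const; apply: ltW.
Qed.

(** With F = |y| the square root of y^2 and D = F - y, the product (y + n + F) D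
    vanishes; y + n and F being squares e^2 and f^2, this makes
    (e D)^2 + (f D)^2 equal to 0, whence D = 0 and y = |y|. *)
Lemma bpos_summand y n : y * n = 0 -> bpos (y + n) -> bpos y.
Proof.
move=> yn [e eE]; have [F [f fE] FF] := bpos_sqrt (bpos_sqr y).
have Fn : F * n = 0.
  apply: sqr_eq0; rewrite mulrACA FF.
  by rewrite -mulrACA yn mulr0.
pose D := F - y.
have FD : F * D = - (y * D).
  apply/eqP; rewrite -addr_eq0 -mulrDl; apply/eqP.
  by transitivity (F * F - y * y); [rewrite /D; ring | rewrite FF subrr].
have eD : (y + n) * D = y * D.
  rewrite mulrDl (_ : n * D = 0) ?addr0 // /D.
  by transitivity (F * n - y * n); [ring | rewrite Fn yn subrr].
have sum0 : (e * D) * (e * D) + (f * D) * (f * D) = 0.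
  transitivity (((e * e) * D + (f * f) * D) * D); first by ring.
  by rewrite -eE -fE eD FD addrN mul0r.
have eD0 := sqr_add_eq0 sum0; rewrite addrC in sum0.
have fD0 := sqr_add_eq0 sum0.
have FD0 : F * D = 0 by rewrite fE -mulrA fD0 mulr0.
have yD0 : y * D = 0 by rewrite -eD eE -mulrA eD0 mulr0.
have D0 : D = 0.
  by apply: sqr_eq0; rewrite {1}/D mulrBl FD0 yD0 subrr.
have -> : y = F by apply/eqP; rewrite eq_sym -subr_eq0 -/D D0.
by exists f.
Qed.

(** y = (|a| + a) / 2 and n = (|a| - a) / 2 have product 0, and their sum |a| is
    positive by construction. *)
Lemma pos_neg_parts a : exists y n, [/\ bpos y, bpos n, y * n = 0 & a = y - n].
Proof.
have [b bp bb] := bpos_sqrt (bpos_sqr a).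
pose h := const t 2^-1.
have h2 : 2%:R * h = 1 by exact: const_half.
pose y := h * (b + a); pose n := h * (b - a).
have yn : y * n = 0.
  transitivity (h * h * (b * b - a * a)); first by rewrite /y /n; ring.
  by rewrite bb subrr mulr0.
have yDn : y + n = b.
  by transitivity (2%:R * h * b); [rewrite /y /n; ring | rewrite h2 mul1r].
exists y, n; split=> //.
- by apply: (bpos_summand yn); rewrite yDn.
- by apply: (@bpos_summand n y); rewrite 1?mulrC 1?addrC ?yDn.
by transitivity (2%:R * h * a); [rewrite h2 mul1r | rewrite /y /n; ring].
Qed.

End Positivity.

(** * Moving the small angles to zero *)

Section ClippedAngle.
Context (R : realType) (A : cstarAlgType R) (H : hilbertModType A) (t : saop H).
Implicit Types (s g f k : bicommutant t) (d eta : R).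

(** With d = eta^2 and tau - d = y - n the decomposition into positive and negative
    parts, h = d + y is max(tau, d), and
      s^2 = y / (1 - d),  g^2 = 1 / ((1 - d) h),  k^2 = y / h.
    The product s g should be close to 1, except where tau is small. It is a
    scalar multiple of k, which is compared to 1 by
      d - (1 - k)^2 tau = d n / h + 2 tau k (1 - k). *)
Lemma clipped_sine (tau : bicommutant t) eta :
  bpos tau -> bpos (1 - tau) -> 0 < eta -> eta <= 2^-1 ->
  exists s g k, [/\ bpos s,
    s * g * g * (tau - tau * tau) = s - s * s * s,
    opbound (s * s - tau) (3%:R * eta ^+ 2),
    bpos (const t (eta ^+ 2) - (1 - k) * (1 - k) * (tau - tau * tau)) &
    opbound (s * g - k) (2%:R * eta ^+ 2)].
Proof.
move=> ptau ptau1 eta0 eta2; set d := eta ^+ 2.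
have d0 : 0 < d by rewrite exprn_gt0.
have d4 : d <= 4%:R^-1 by rewrite /d expr2; nra.
have [y [n [py pn yn tauE]]] := pos_neg_parts (tau - const t d).
pose c := const t d; rewrite -/c in tauE *.
have {}tauE : tau = c + y - n by rewrite -addrA -tauE addrC subrK.
have [g pg cyg] := bpos_inv d0 py; rewrite -/c in cyg.
pose q := (1 - d)^-1; have q0 : 0 < q by rewrite invr_gt0; lra.
have qd : q - d * q = 1 by rewrite /q; field; lra.
pose cq := const t q.
have cqE : cq - c * cq = 1 by rewrite /c /cq -rmorphM -rmorphB qd rmorph1.
have pcq : bpos cq by apply/bpos_const/ltW.
have pc : bpos c by apply/bpos_const/ltW.
have [s ps ss] := bpos_sqrt (bposM pcq py).
have [gam pgam gg] := bpos_sqrt (bposM pcq pg).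
pose k := (1 - c) * (s * gam).
have p1c : bpos (1 - c) by rewrite -(rmorph1 (const t)) -rmorphB; apply: bpos_const; lra.
have pk : bpos k by apply: bposM => //; apply: bposM.
(* s vanishes where tau < d: this is what the truncation is for. *)
have sn : s * n = 0.
  by apply: sqr_eq0; rewrite mulrACA ss -mulrA (mulrA y) yn mul0r mulr0.
have kk : k * k = y * g.
  transitivity ((1 - c) * (1 - c) * (s * s) * (gam * gam)); first by rewrite /k; ring.
  rewrite ss gg; transitivity ((cq - c * cq) * (cq - c * cq) * (y * g)); first by ring.
  by rewrite cqE !mul1r.
have kk1 : 1 - k * k = c * g by rewrite kk -cyg; ring.
have pk1 : opbound k 1.
  apply: bicomm_opbound_of_sqr => //; rewrite expr1n rmorph1 kk1; exact: bposM.
have p1k : bpos (1 - k) by apply: bpos_1B.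
have y1 : opbound y 1.
  apply: bicomm_opbound_of_sqr => //; rewrite expr1n rmorph1.
  have -> : 1 - y * y = (1 - tau) * (1 + tau) + ((c - n) * (c - n) + 2%:R * c * y).
    transitivity ((1 - tau) * (1 + tau) + ((c - n) * (c - n) + 2%:R * c * y) - 2%:R * (y * n)).
      by rewrite tauE; ring.
    by rewrite yn mulr0 subr0.
  have p1 := bpos1 t.
  apply: bposD; first by apply: bposM => //; apply: bposD.
  apply: bposD; first exact: bpos_sqr.
  rewrite -mulrA mulr_natl mulr2n; apply: bposD; exact: bposM.
have cn : opbound (c - n) d.
  apply: bicomm_opbound_of_sqr; first exact: ltW.
  rewrite expr2 rmorphM /= -/c.
  have -> : c * c - (c - n) * (c - n) = n * c + n * tau.
    transitivity (n * c + n * tau - y * n); first by rewrite tauE; ring.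
    by rewrite yn subr0.
  by apply: bposD; apply: bposM.
have sgk : s * gam - k = c * (s * gam) by rewrite /k; ring.
have sgk2 : s * gam - k = const t (d * q) * k.
  rewrite sgk rmorphM /= -/c -/cq /k.
  transitivity (c * (cq - c * cq) * (s * gam)); last by ring.
  by rewrite cqE mulr1.
exists s, gam, k; split=> //.
- have stau : s * tau = s * (c + y) by rewrite tauE mulrBr sn subr0.
  transitivity ((gam * gam) * (s * tau - (s * tau) * tau)); first by ring.
  transitivity (gam * gam * (s * tau - (c + y) * (s * tau))).
    by rewrite stau; congr (_ * (_ - _)); rewrite mulrAC stau mulrC.
  rewrite stau gg.
  transitivity (((c + y) * g) * s * (cq - c * cq - cq * y)); first by ring.
  by rewrite cyg cqE -ss; ring.
- have -> : s * s - tau = const t (d * q) * y - (c - n).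
    rewrite ss tauE rmorphM /= -/c -/cq.
    transitivity (c * cq * y + (cq - c * cq) * y - (c + y - n)); first by ring.
    by rewrite cqE; ring.
  have dq0 : 0 <= d * q by rewrite mulr_ge0 // ltW.
  apply: (opbound_le (c := d * q * 1 + d)); first nra.
  apply: (opboundD (T2 := fun x => - (c - n) x)); last exact: opboundN.
  by apply: opboundM => //; apply: opbound_const.
- have -> : c - (1 - k) * (1 - k) * (tau - tau * tau) =
     c * n * g + 2%:R * (tau * k * (1 - k)) + ((1 - k) * tau) * ((1 - k) * tau).
    transitivity (c + (2%:R * k - 1) * tau - (k * k) * tau + ((1 - k) * tau) * ((1 - k) * tau)); first by ring.
    congr (_ + _).
    have yg : k * k * tau = y.
      transitivity (y * ((c + y) * g) - g * (y * n)); first by rewrite kk tauE; ring.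
      by rewrite cyg yn mulr1 mulr0 subr0.
    have cgn : c * n * g = n.
      transitivity (n * ((c + y) * g) - g * (y * n)); first by ring.
      by rewrite cyg yn mulr1 mulr0 subr0.
    rewrite cgn.
    transitivity (n + 2%:R * (tau * k) - 2%:R * (k * k * tau)); last by ring.
    by rewrite yg tauE; ring.
  apply: bposD; last exact: bpos_sqr.
  apply: bposD; first by apply: bposM => //; apply: bposM.
  by rewrite mulr_natl mulr2n; apply: bposD; apply: bposM => //; apply: bposM.
- rewrite sgk2.
  have dq0 : 0 <= d * q by rewrite mulr_ge0 // ltW.
  apply: (opbound_le (c := d * q * 1)); first nra.
  by apply: opboundM => //; apply: opbound_const.
Qed.

End ClippedAngle.

(** * Operators with central coefficients *)

Section Combinations.
Context (R : realType) (A : cstarAlgType R) (H : hilbertModType A) (t : saop H).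
Implicit Types (a b c e z : bicommutant t) (x y v w : H).

Lemma bicommL z x y : z (x + y) = z x + z y.
Proof. exact: adjointD (bicomm_selfadjoint z). Qed.

(** Linear combinations of four vectors. Writing both sides of an identity between
    vectors in this form reduces it to identities in the commutative ring. *)
Definition comb a b c e x y v w := a x + b y + (c v + e w).

Lemma combD a b c e a' b' c' e' x y v w :
  comb a b c e x y v w + comb a' b' c' e' x y v w =
  comb (a + a') (b + b') (c + c') (e + e') x y v w.
Proof. by rewrite /comb addrACA [X in X + _]addrACA [X in _ + X]addrACA. Qed.

Lemma combN a b c e x y v w :
  - comb a b c e x y v w = comb (- a) (- b) (- c) (- e) x y v w.
Proof. by rewrite /comb !opprD. Qed.

Lemma combZ z a b c e x y v w :
  z (comb a b c e x y v w) = comb (z * a) (z * b) (z * c) (z * e) x y v w.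
Proof. by rewrite /comb !bicommL. Qed.

Lemma saop_comb (W : saop H) a b c e x y v w : (forall x, W (t x) = t (W x)) ->
  W (comb a b c e x y v w) = comb a b c e (W x) (W y) (W v) (W w).
Proof.
by move=> Wt; rewrite /comb !(adjointD _ _ (saop_selfadjoint W)) !(bicomm_commute _ Wt).
Qed.

End Combinations.

Section Quaternions.
Context (R : realType) (A : cstarAlgType R) (H : hilbertModType A) (t : saop H).
Context (P N : saop H) (u : bicommutant t).
Hypothesis Pt : forall x, P (t x) = t (P x).
Hypothesis Nt : forall x, N (t x) = t (N x).
Hypothesis PP : forall x, P (P x) = P x.
Hypothesis PNNP : forall x, N (P x) = N x - P (N x).
Hypothesis NN : forall x, N (N x) = u x.
Implicit Types (a b c e z : bicommutant t).

(** The operator a + b P + c N + e P N. When P is idempotent, N P = N - P N and N^2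
    is central, these operators form a (generalised) quaternion algebra: it is
    the algebra generated by P and Q over the functions of their angle. *)
Definition quat a b c e : H -> H :=
  fun x => comb a b c e x (P x) (N x) (P (N x)).

Lemma quat_idem a b c e x : P (quat a b c e x) = quat 0 (a + b) 0 (c + e) x.
Proof. by rewrite /quat saop_comb // !PP /comb !bicomm0 !add0r. Qed.

Lemma quat_offdiag a b c e x :
  N (quat a b c e x) = quat (u * (c + e)) (- (u * e)) (a + b) (- b) x.
Proof.
have NE : N x = quat 0 0 1 0 x.
  by rewrite /quat /comb !bicomm0 bicomm1 !(add0r, addr0).
have NPE : N (P x) = quat 0 0 1 (-1) x.
  by rewrite PNNP /quat /comb !bicomm0 bicommN !bicomm1 !add0r.
have NNE : N (N x) = quat u 0 0 0 x by rewrite NN /quat /comb !bicomm0 !addr0.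
have NPNE : N (P (N x)) = quat u (- u) 0 0 x.
  by rewrite PNNP NN (bicomm_commute _ Pt) /quat /comb !bicomm0 !addr0 bicommN.
rewrite {1}/quat saop_comb // NPNE NNE NPE NE /comb !combZ !combD.
by congr (comb _ _ _ _ x _ _ _); ring.
Qed.

Lemma quat_comp a b c e a' b' c' e' x :
  quat a b c e (quat a' b' c' e' x) =
  quat (a * a' + u * c * (c' + e')) (a * b' + b * (a' + b') - u * c * e' + u * e * c')
       (a * c' + c * (a' + b')) (a * e' + b * (c' + e') + e * a' - c * b') x.
Proof.
rewrite {1}/quat /comb !quat_offdiag !quat_idem !combZ !combD.
by congr (comb _ _ _ _ x _ _ _); ring.
Qed.

Lemma quat_adjoint a b c e : is_adjoint (quat a b c e) (quat a b (c + e) (- e)).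
Proof.
move=> x y; rewrite /quat /comb !hinnerDl !hinnerDr.
rewrite !(bicomm_selfadjoint a) !(bicomm_selfadjoint b) !(bicomm_selfadjoint c) !(bicomm_selfadjoint e).
rewrite !(saop_selfadjoint P) !(saop_selfadjoint N).
rewrite !(bicomm_commute _ Pt) !(bicomm_commute _ Nt) PNNP; congr (_ + _).
by rewrite bicommN (adjointB _ _ (bicomm_selfadjoint e)) [in LHS]hinnerDr addrA.
Qed.

End Quaternions.

(** * The algebra generated by two projections *)

Section TwoProjections.
Context (R : realType) (A : cstarAlgType R) (H : hilbertModType A).
Implicit Types (P Q : H -> H).

(** The reflection 2 P - 1 is self-adjoint with square 1, hence unitary. *)
Lemma reflection_isometry P x : is_projection P -> nrm (P x + P x - x) = nrm x.
Proof.
move=> [hP PP]; apply: (@eq_nrm R A H).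
have PPx : P (P x) = P x := PP x.
have PE : hinner (P x) x = hinner (P x) (P x) :> A by rewrite hP [RHS]hP PPx.
have PE' : hinner x (P x) = hinner (P x) (P x) :> A by rewrite -hP PE.
set w := P x + P x - x.
have Pw : hinner (P x) w = hinner (P x) (P x) :> A.
  by rewrite !hinnerDr hinnerNr PE addrK.
have xw : hinner x w = hinner (P x) (P x) + hinner (P x) (P x) - hinner x x :> A.
  by rewrite !hinnerDr hinnerNr PE'.
by rewrite {1}/w !hinnerDl hinnerNl Pw xw subKr.
Qed.

Lemma projection_opbound P : is_projection P -> opbound P 1.
Proof.
move=> hP x; rewrite mul1r.
have := nrmD (P x + P x - x) x; rewrite reflection_isometry // subrK.
have -> : P x + P x = (2%:R)%:C *: P x by rewrite (rmorph_nat (real_complex R) 2) scaler_nat mulr2n.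
by rewrite nrmZr ger0_norm //; lra.
Qed.

Variables (P Q : H -> H).
Hypotheses (hP : is_projection P) (hQ : is_projection Q).

Let P_sa : selfadjoint P := hP.1.
Let Q_sa : selfadjoint Q := hQ.1.

Definition proj_diff x := P x - Q x.

Lemma proj_diff_selfadjoint : selfadjoint proj_diff.
Proof.
by move=> x y; rewrite hinnerDl hinnerDr hinnerNl hinnerNr P_sa Q_sa.
Qed.

Let D_add x y : proj_diff (x + y) = proj_diff x + proj_diff y.
Proof. exact: adjointD proj_diff_selfadjoint. Qed.
Let D_sub x y : proj_diff (x - y) = proj_diff x - proj_diff y.
Proof. exact: adjointB proj_diff_selfadjoint. Qed.

Lemma proj_diff_bounded : opbound proj_diff 2%:R.
Proof.
have := opboundD (projection_opbound hP) (opboundN (projection_opbound hQ)).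
exact.
Qed.

Lemma proj_diff_sqr_selfadjoint : selfadjoint (fun x => proj_diff (proj_diff x)).
Proof. by move=> x y; rewrite !proj_diff_selfadjoint. Qed.

Lemma proj_diff_sqr_bounded : bounded_op (fun x => proj_diff (proj_diff x)).
Proof.
exists (2%:R * 2%:R) => x; rewrite (le_trans (proj_diff_bounded _)) // -mulrA.
by rewrite ler_wpM2l // proj_diff_bounded.
Qed.

(** The square of the sine of the angle between P and Q. *)
Definition separation := SAOp proj_diff_sqr_selfadjoint proj_diff_sqr_bounded.

(** In terms of J = 2 P - 1 and D = P - Q this is J D + D J = 2 D^2; all the
    relations between P, N and tau follow from it. *)
Lemma proj_diff_anticomm x :
  P (proj_diff x) = proj_diff x + separation x - proj_diff (P x).
Proof.
have PP y : P (P y) = P y := hP.2 y; have QQ y : Q (Q y) = Q y := hQ.2 y.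
rewrite /= /proj_diff !(adjointB _ _ P_sa) !(adjointB _ _ Q_sa) !PP QQ.
by rewrite opprB addrCA subrKA addrK.
Qed.

Definition P_saop := SAOp P_sa (ex_intro _ 1 (projection_opbound hP)).
Definition D_saop := SAOp proj_diff_selfadjoint (ex_intro _ 2%:R proj_diff_bounded).

Lemma projection_comm_separation x : P (separation x) = separation (P x).
Proof.
rewrite {1}/separation /= proj_diff_anticomm proj_diff_anticomm.
rewrite (D_sub (_ + _)) (D_add _ (separation x)).
by rewrite -[separation (proj_diff x)]/(proj_diff (separation x)) subKr.
Qed.

Lemma separation_in : (separation : H -> H) \in in_bicommutant separation.
Proof.
by apply/asboolP; split => //; [exact: proj_diff_sqr_selfadjoint | exact: proj_diff_sqr_bounded].
Qed.

Definition sep : bicommutant separation := Bicommutant separation_in.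

(** The off-diagonal part P Q (1 - P) + (1 - P) Q P of Q, in the form
    tau (2 P - 1) - (P - Q). *)
Definition offdiag x := sep (P x) + sep (P x) - sep x - proj_diff x.

Let D_comb a b c e (x y v w : H) : proj_diff (comb (t := separation) a b c e x y v w) =
  comb a b c e (proj_diff x) (proj_diff y) (proj_diff v) (proj_diff w).
Proof. exact: (@saop_comb _ _ _ _ D_saop). Qed.

Let P_comb a b c e (x y v w : H) : P (comb (t := separation) a b c e x y v w) =
  comb a b c e (P x) (P y) (P v) (P w).
Proof. apply: (@saop_comb _ _ _ _ P_saop); exact: projection_comm_separation. Qed.

(* Combinations of x, P x, D x and D P x, with D = P - Q: a basis in which P, D and
   N are computed from the relation between P and D alone. *)
Let std (a b c e : bicommutant separation) x :=
  comb a b c e x (P x) (proj_diff x) (proj_diff (P x)).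

Let D_std a b c e x : proj_diff (std a b c e x) = std (sep * c) (sep * e) a b x.
Proof.
rewrite /std D_comb /comb addrC; congr (_ + _).
by rewrite !bicommM bicommC (bicommC sep e).
Qed.

Let stdP x : P x = std 0 1 0 0 x.
Proof. by rewrite /std /comb !bicomm0 bicomm1 !(addr0, add0r). Qed.

Let stdD x : proj_diff x = std 0 0 1 0 x.
Proof. by rewrite /std /comb !bicomm0 bicomm1 !(addr0, add0r). Qed.

Let P_std a b c e x : P (std a b c e x) = std (sep * c) (a + b + sep * e) c (- c) x.
Proof.
have PP y : P (P y) = P y := hP.2 y.
have PD : P (proj_diff x) = std sep 0 1 (-1) x.
  rewrite proj_diff_anticomm /std /comb bicomm0 bicommN !bicomm1 addr0.
  by rewrite -addrA [RHS]addrCA.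
have PDP : P (proj_diff (P x)) = std 0 sep 0 0 x.
  rewrite proj_diff_anticomm PP addrC addKr.
  by rewrite /std /comb !bicomm0 !(addr0, add0r).
rewrite {1}/std P_comb PP PD PDP {1}/comb (stdP x) /std !combZ !combD.
by congr (comb _ _ _ _ _ _ _ _); ring.
Qed.

Let N_std a b c e x : offdiag (std a b c e x) =
  std (sep * (2%:R * sep * c - a - c)) (sep * (2%:R * a + b + 2%:R * sep * e - e))
      (sep * c - a) (- (2%:R * sep * c) - sep * e - b) x.
Proof.
rewrite /offdiag P_std D_std /std !combZ !combN !combD.
by congr (comb _ _ _ _ _ _ _ _); ring.
Qed.

Let stdN x : offdiag x = std (- sep) (2%:R * sep) (-1) 0 x.
Proof.
rewrite /std /comb mulr_natl mulr2n bicommD !bicommN bicomm0 bicomm1 addr0.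
by rewrite [- _ + _]addrC.
Qed.

Lemma offdiag_projection x : offdiag (P x) = offdiag x - P (offdiag x).
Proof.
rewrite [P x]stdP (stdN x) P_std N_std /std combN combD.
by congr (comb _ _ _ _ _ _ _ _); ring.
Qed.

Lemma offdiag_sqr x : offdiag (offdiag x) = (sep - sep * sep) x.
Proof.
rewrite [offdiag x]stdN N_std.
transitivity (std (sep - sep * sep) 0 0 0 x); last by rewrite /std /comb !bicomm0 !addr0.
by congr (comb _ _ _ _ _ _ _ _); ring.
Qed.

Lemma offdiag_selfadjoint : selfadjoint offdiag.
Proof.
move=> x y.
have linl a b d : hinner (a + a - b - d) y =
    hinner a y + hinner a y - hinner b y - hinner d y :> A.
  by rewrite !hinnerDl !hinnerNl.
have linr a b d : hinner x (a + a - b - d) =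
    hinner x a + hinner x a - hinner x b - hinner x d :> A.
  by rewrite !hinnerDr !hinnerNr.
have sepP : hinner (sep (P x)) y = hinner x (sep (P y)) :> A.
  by rewrite (bicomm_selfadjoint sep) P_sa; congr hinner; apply: projection_comm_separation.
by rewrite /offdiag linl linr sepP (bicomm_selfadjoint sep) proj_diff_selfadjoint.
Qed.

Lemma offdiag_bounded : bounded_op offdiag.
Proof.
have [c bc] := bicomm_bounded sep.
have b1 : opbound (fun x => sep (P x)) (`|c| * 1).
  move=> x; rewrite (le_trans (opbound_wf bc _)) // -mulrA ler_wpM2l //.
  exact: projection_opbound.
exists (`|c| * 1 + `|c| * 1 + c + 2%:R).
apply: (opboundD (T2 := fun x => - proj_diff x)); last exact/opboundN/proj_diff_bounded.
apply: (opboundD (T2 := fun x => - sep x)); last exact/opboundN.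
exact: opboundD.
Qed.

Definition N_saop := SAOp offdiag_selfadjoint offdiag_bounded.

Lemma offdiag_comm_separation x : offdiag (separation x) = separation (offdiag x).
Proof.
have sepE y : separation y = std sep 0 0 0 y by rewrite /std /comb !bicomm0 !addr0.
rewrite -[RHS]/(sep (offdiag x)) sepE (stdN x) N_std /std combZ.
by congr (comb _ _ _ _ _ _ _ _); ring.
Qed.

Local Notation pquat := (quat (t := separation) P_saop N_saop).

Lemma pquat_comp a b c e a' b' c' e' x :
  pquat a b c e (pquat a' b' c' e' x) =
  pquat (a * a' + (sep - sep * sep) * c * (c' + e'))
    (a * b' + b * (a' + b') - (sep - sep * sep) * c * e' + (sep - sep * sep) * e * c')
    (a * c' + c * (a' + b')) (a * e' + b * (c' + e') + e * a' - c * b') x.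
Proof.
apply: quat_comp.
- exact: projection_comm_separation.
- exact: offdiag_comm_separation.
- by move=> y; apply: hP.2.
- exact: offdiag_projection.
- exact: offdiag_sqr.
Qed.

Lemma pquat_adjoint a b c e : is_adjoint (pquat a b c e) (pquat a b (c + e) (- e)).
Proof.
apply: quat_adjoint.
- exact: projection_comm_separation.
- exact: offdiag_comm_separation.
- exact: offdiag_projection.
Qed.

Lemma pquat_P x : P x = pquat 0 1 0 0 x.
Proof. by rewrite /quat /comb !bicomm0 bicomm1 !(addr0, add0r). Qed.

Lemma pquat_Q x : Q x = pquat sep (1 - 2%:R * sep) 1 0 x.
Proof.
have -> : Q x = P x - proj_diff x by exact: (esym (subKr _ _)).
rewrite stdP stdD /quat /= [offdiag x in RHS]stdN {1}/comb bicomm1 bicomm0 addr0.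
rewrite [P x in RHS]stdP.
have xE : x = std 1 0 0 0 x by rewrite /std /comb !bicomm0 bicomm1 !addr0.
rewrite [in sep x]xE /std !combZ !combN !combD.
by congr (comb _ _ _ _ _ _ _ _); ring.
Qed.

(** The square of 1 - 2 tau and the square of 2 N add up to 1. *)
Lemma sep_bound : opbound (1 - 2%:R * sep) 1.
Proof.
apply: (opbound_of_sqr (C := fun x => offdiag x + offdiag x)) => //.
- exact: bicomm_selfadjoint.
- by move=> x y; rewrite hinnerDl hinnerDr offdiag_selfadjoint.
- move=> x; rewrite bicommL; congr (_ + _); apply: esym;
    exact: (bicomm_commute (W := N_saop) _ offdiag_comm_separation).
move=> x; rewrite expr1n scale1r (adjointD _ _ offdiag_selfadjoint) offdiag_sqr.
rewrite -!bicommD -bicommM -bicommD -[RHS](bicomm1 separation).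
by congr (bicomm_op _ _); ring.
Qed.

Lemma bpos_sep : bpos sep.
Proof.
have -> : sep = const separation 2^-1 * (1 - (1 - 2%:R * sep)).
  by rewrite subKr mulrA [const _ _ * _]mulrC const_half mul1r.
apply: bposM; last exact/bpos_1B/sep_bound.
by apply: bpos_const; rewrite invr_ge0.
Qed.

Lemma bpos_1sep : bpos (1 - sep).
Proof.
have -> : 1 - sep = const separation 2^-1 * (1 - - (1 - 2%:R * sep)).
  transitivity (2%:R * const separation 2^-1 * (1 - sep)); last by ring.
  by rewrite const_half mul1r.
apply: bposM; first by apply: bpos_const; rewrite invr_ge0.
exact/bpos_1B/opboundN/sep_bound.
Qed.

End TwoProjections.

(** * The perturbed projection and the equation *)

Section Perturbation.
Context (R : realType) (A : cstarAlgType R) (H : hilbertModType A).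
Variables (P Q : H -> H).
Hypotheses (hP : is_projection P) (hQ : is_projection Q).

Local Notation T := (separation hP hQ).
Local Notation tau := (sep hP hQ).
Local Notation N := (offdiag hP hQ).
Local Notation pquat := (quat (t := T) (P_saop hP) (N_saop hP hQ)).

Lemma eq_quat (a b c e a' b' c' e' : bicommutant T) x :
  a = a' -> b = b' -> c = c' -> e = e' -> pquat a b c e x = pquat a' b' c' e' x.
Proof. by move=> -> -> -> ->. Qed.

Lemma pquat_selfadjoint (a b c : bicommutant T) : selfadjoint (pquat a b c 0).
Proof. by have := pquat_adjoint a b c 0; rewrite addr0 oppr0. Qed.

(** The square of z N is z^2 (tau - tau^2). *)
Lemma central_offdiag_opbound (z C : bicommutant T) (c : R) : 0 <= c ->
  C * C = const T (c ^+ 2) - z * z * (tau - tau * tau) -> opbound (fun x => z (N x)) c.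
Proof.
move=> c0 CE.
have Nz (w : bicommutant T) x : N (w x) = w (N x) := bicomm_commute (W := N_saop hP hQ) w (offdiag_comm_separation hP hQ) x.
apply: (opbound_of_sqr (C := C)) => //; try exact: bicomm_selfadjoint.
- by move=> x y; rewrite (bicomm_selfadjoint z) offdiag_selfadjoint Nz.
- by move=> x; rewrite Nz bicommC.
move=> x; rewrite Nz offdiag_sqr -!bicommM -bicommD CE.
rewrite -[RHS]/(const T (c ^+ 2) x); congr (bicomm_op _ _); ring.
Qed.

Variables (s g : bicommutant T).
Hypothesis ps : bpos s.
Hypothesis sgg : s * g * g * (tau - tau * tau) = s - s * s * s.

(** The projection at the angle whose sine is s; Q is the case where s^2 = tau and
    s g = 1. *)
Definition perturbed := pquat (s * s) (1 - 2%:R * (s * s)) (s * g) 0.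

Lemma perturbed_projection : is_projection perturbed.
Proof.
split; first exact: pquat_selfadjoint.
move=> x; rewrite /perturbed /= pquat_comp.
apply: eq_quat; try by ring.
transitivity (s * s * s * s + s * (s * g * g * (tau - tau * tau))); first by ring.
by rewrite sgg; ring.
Qed.

Lemma perturbed_sum x :
  P x + perturbed x = pquat (s * s) (2%:R - 2%:R * (s * s)) (s * g) 0 x.
Proof.
rewrite (pquat_P hP hQ x) /perturbed /quat combD.
by congr (comb _ _ _ _ _ _ _ _); ring.
Qed.

(** Q - Q' is (s^2 - tau) (2 P - 1) + (1 - k) N - (s g - k) N, where 2 P - 1 is an
    isometry and N a contraction. *)
Lemma perturbed_dist k (eta : R) : 0 < eta ->
  opbound (s * s - tau) (3%:R * eta ^+ 2) ->
  bpos (const T (eta ^+ 2) - (1 - k) * (1 - k) * (tau - tau * tau)) ->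
  opbound (s * g - k) (2%:R * eta ^+ 2) ->
  opbound (fun x => Q x - perturbed x) (eta + 5%:R * eta ^+ 2).
Proof.
move=> eta0 bs [C CE] bg x.
have e2 : 0 <= eta ^+ 2 by rewrite exprn_ge0 // ltW.
have -> : Q x - perturbed x =
    (s * s - tau) (P x + P x - x) + ((1 - k) (N x) - (s * g - k) (N x)).
  have -> : (s * s - tau) (P x + P x - x) =
      pquat (- (s * s - tau)) (2%:R * (s * s - tau)) 0 0 x.
    move: (s * s - tau) => z.
    rewrite /quat /comb !bicomm0 !addr0 mulr_natl mulr2n bicommD bicommN !bicommL.
    by rewrite (adjointN _ (bicomm_selfadjoint _)) addrC.
  have -> : (1 - k) (N x) - (s * g - k) (N x) = pquat 0 0 (1 - s * g) 0 x.
    rewrite /quat /comb !bicomm0 !(addr0, add0r) -bicommN -bicommD.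
    by congr (bicomm_op _ _); ring.
  rewrite (pquat_Q hP hQ x) /perturbed /quat combN !combD.
  by congr (comb _ _ _ _ _ _ _ _); ring.
have bN : opbound (fun x => (1 : bicommutant T) (N x)) 1.
  have [C' CE'] : bpos (1 - tau + tau * tau).
    by apply: bposD; [exact: bpos_1sep | exact: bpos_sqr].
  apply: (central_offdiag_opbound (C := C')) => //.
  by rewrite -CE' expr1n rmorph1; ring.
have b1 := bs (P x + P x - x); rewrite reflection_isometry // in b1.
have b2 := central_offdiag_opbound (ltW eta0) (esym CE) x.
have b3 := bg (N x).
have b4 := bN x; rewrite bicomm1 in b4.
have t1 := nrmD ((s * s - tau) (P x + P x - x)) ((1 - k) (N x) - (s * g - k) (N x)).
have t2 := nrmD ((1 - k) (N x)) (- (s * g - k) (N x)).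
rewrite nrmN in t2.
have b5 := le_trans b3 (ler_wpM2l (mulr_ge0 (ler0n _ 2) e2) b4).
apply: (le_trans t1); apply: (le_trans (lerD b1 (le_trans t2 (lerD b2 b5)))).
rewrite le_eqVlt; apply/orP; left; apply/eqP; ring.
Qed.

(** The formulas S = (P + Q' + s) f and X = f ((1 + s) P - g N P), with
    f = (2 (1 + s))^(-1/2), come from the square root (M + det^(1/2)) /
    (tr + 2 det^(1/2))^(1/2) of a 2 x 2 matrix M, here with trace 2 and
    determinant s^2. The same formula applied to S, whose determinant is
    s and whose trace is (2 (1 + s))^(1/2), gives a self-adjoint square root B of S,
    and this is how S is seen to be positive. *)
Lemma perturbed_solvable : exists S : H -> H,
  is_sqrt_op (P \+ perturbed) S /\ exists X : H -> H, adjointable X /\ S \o X =1 P.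
Proof.
have [i pi iE] : exists2 i, bpos i & (2%:R + 2%:R * s) * i = 1.
  have p2 : 0 < 2%:R :> R by [].
  have := bpos_inv (Z := 2%:R * s) p2; rewrite rmorph_nat; apply.
  by rewrite mulr_natl mulr2n; apply: bposD.
have [f pf fE] := bpos_sqrt pi.
have [r pr rE] := bpos_sqrt ps.
(* The trace of S is (2 + 2 s) f, with inverse f, so that v^2 is the inverse of
   tr S + 2 r, as the relation v0 below says. *)
have [j pj jE] : exists2 j, bpos j & (1 + 2%:R * (r * f)) * j = 1.
  have := @bpos_inv _ _ _ T (2%:R * (r * f)) 1 ltr01; rewrite rmorph1; apply.
  by rewrite mulr_natl mulr2n; apply: bposD; apply: bposM.
have [v pv vE] := bpos_sqrt (bposM pf pj).
have ff : (2%:R + 2%:R * s) * (f * f) = 1 by rewrite fE.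
pose S := pquat (f * (s * s + s)) (f * (2%:R - 2%:R * (s * s))) (f * (s * g)) 0.
pose B := pquat (v * (f * (s * s + s) + r)) (v * (f * (2%:R - 2%:R * (s * s)))) (v * (f * (s * g))) 0.
have r0 : r * r - s = 0 by rewrite rE subrr.
have g0 : s * g * g * (tau - tau * tau) - (s - s * s * s) = 0 by rewrite sgg subrr.
have f0 : (2%:R + 2%:R * s) * (f * f) - 1 = 0 by rewrite ff subrr.
have v0 : v * v * (f * (2%:R + 2%:R * s) + 2%:R * r) - 1 = 0.
  apply/eqP; rewrite subr_eq0; apply/eqP; rewrite vE.
  transitivity (j * ((2%:R + 2%:R * s) * (f * f) + 2%:R * (r * f))); first by ring.
  by rewrite ff mulrC.
(* Each coefficient is compared by exhibiting the difference as a combination of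
   the relations r0, g0, f0 and v0. *)
have bycomb (a b z : bicommutant T) : a - b = z -> z = 0 -> a = b.
  by move=> <- /eqP; rewrite subr_eq0 => /eqP.
exists S; split; [split|].
- exists B, B; split; first exact: pquat_selfadjoint.
  move=> x; rewrite /B /S /= pquat_comp.
  apply: eq_quat; last by ring.
  + apply: (@bycomb _ _ (- (f * (s * s + s)) * (v * v * (f * (2%:R + 2%:R * s) + 2%:R * r) - 1)
      - v * v * (r * r - s) - v * v * f * f * s * (s * g * g * (tau - tau * tau) - (s - s * s * s))
      + v * v * s * ((2%:R + 2%:R * s) * (f * f) - 1))); first by ring.
    by rewrite v0 r0 g0 f0 !mulr0 !subrr addr0.
  + apply: (@bycomb _ _ (- (f * (2%:R - 2%:R * (s * s))) *
      (v * v * (f * (2%:R + 2%:R * s) + 2%:R * r) - 1))); first by ring.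
    by rewrite v0 mulr0.
  apply: (@bycomb _ _ (- (f * (s * g)) *
      (v * v * (f * (2%:R + 2%:R * s) + 2%:R * r) - 1))); first by ring.
  by rewrite v0 mulr0.
- move=> x; rewrite /= /S pquat_comp perturbed_sum.
  apply: eq_quat; last by ring.
  + apply: (@bycomb _ _ (s * s * ((2%:R + 2%:R * s) * (f * f) - 1)
      + f * f * s * (s * g * g * (tau - tau * tau) - (s - s * s * s)))); first by ring.
    by rewrite g0 f0 !mulr0 addr0.
  + apply: (@bycomb _ _ ((2%:R - 2%:R * (s * s)) * ((2%:R + 2%:R * s) * (f * f) - 1))).
      by ring.
    by rewrite f0 mulr0.
  apply: (@bycomb _ _ ((s * g) * ((2%:R + 2%:R * s) * (f * f) - 1))); first by ring.
  by rewrite f0 mulr0.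
exists (pquat 0 (f * (1 + s)) (- (f * g)) (f * g)); split.
  by eexists; apply: pquat_adjoint.
move=> x; rewrite /= /S pquat_comp (pquat_P hP hQ x).
apply: eq_quat; try by ring.
apply: (@bycomb _ _ (((2%:R + 2%:R * s) * (f * f) - 1)
   - f * f * (s * g * g * (tau - tau * tau) - (s - s * s * s)))); first by ring.
by rewrite f0 g0 mulr0 subr0.
Qed.

End Perturbation.

Theorem theorem3p2 (R : realType) (A : cstarAlgType R) (H : hilbertModType A)
    (P Q : H -> H) (hP : is_projection P) (hQ : is_projection Q)
    (eps : R) (eps_gt0 : 0 < eps) (eps_lt1 : eps < 1) :
  exists Q' : H -> H,
    [/\ is_projection Q',
        (opnorm (Q \- Q')%R < eps%:E)%E
      & exists S : H -> H,
          is_sqrt_op (P \+ Q') S /\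
          exists X : H -> H, adjointable X /\ S \o X =1 P].
Proof.
(* The distance is at most eta + 5 eta^2, and eta < 1 / 8. *)
pose eta := eps / 8%:R.
have eta0 : 0 < eta by rewrite divr_gt0.
have eta2 : eta <= 2^-1 by rewrite /eta; lra.
have [s [g [k [ps sgg bs pk bg]]]] :=
  clipped_sine (bpos_sep hP hQ) (bpos_1sep hP hQ) eta0 eta2.
exists (perturbed s g); split.
- exact: perturbed_projection.
- have bd := perturbed_dist eta0 bs pk bg.
  apply: (@le_lt_trans _ _ (eta + 5%:R * eta ^+ 2)%:E); last first.
    by rewrite lte_fin /eta expr2; nra.
  apply: ub_ereal_sup => _ [x x1 <-]; rewrite lee_fin.
  have nx1 : nrm x <= 1 by rewrite -lecR -nrmE.
  apply: (le_trans (bd x)); rewrite ler_piMr //.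
  by rewrite addr_ge0 ?mulr_ge0 ?exprn_ge0 // ltW.
exact: perturbed_solvable.
Qed.
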